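(* Let $G=(V,E)$ be a finite connected graph, and let $S,T\subseteq V$ be the sets of source and target nodes, respectively. Then $\mathfrak S(G)\le\mathfrak C(G)$ deterministically (for every realisation of the cutting procedure), with equality if $S\subseteq T$. Conversely, if $\mathfrak S(G)=\mathfrak C(G)$ in distribution, then $S\subseteq T$. Moreover, all of these statements also hold for $\mathfrak S_c(G)$ and $\mathfrak C_c(G)$ in the continuous-time model: $\mathfrak S_c(G)\le\mathfrak C_c(G)$ deterministically, with equality if $S\subseteq T$, and if $\mathfrak S_c(G)=\mathfrak C_c(G)$ in distribution then $S\subseteq T$.
   Context: Discrete cutting procedure. Let $G$ be a finite simple connected graph with a nonempty set $S\subseteq V(G)$ of sources and a set $T\subseteq V(G)$ of targets. Put $G_0=G$. As long as $G_{i-1}$ is nonempty, choose $v_i\in V(G_{i-1})$ uniformly at random (independently of the past), delete $v_i$ and its incident edges, and discard all connected components that contain no source; the result is $G_i$. The process stops when the empty graph $\emptyset$ is reached. Cutting number: $\mathfrak C(G)=\inf\{i\ge0:G_i=\emptyset\}$. Separation number: $\mathfrak S(G)=\inf\{i\ge0:V(G_i)\cap T=\emptyset\}$. Continuous-time model. Equip the vertices with i.i.d. $\mathrm{Exp}(1)$ clocks $(X_v)_{v\in V}$. Start from $G$ at time $0$; at each time $X_v$, if $v$ is still present, delete $v$ and its incident edges and discard all components containing no source. Let $G_t$ be the graph at time $t$ (after any cut made at time $t$). Then $\mathfrak C_c(G)=\inf\{t\ge0:G_t=\emptyset\}$ and $\mathfrak S_c(G)=\inf\{t\ge0:V(G_t)\cap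 T=\emptyset\}$. *)

(* Defs.v *)
From mathcomp Require Import all_boot all_order all_algebra.
From mathcomp Require Import all_classical all_reals all_analysis.
From mathcomp Require Import measurable_realfun.

Set Implicit Arguments.
Unset Strict Implicit.
Unset Printing Implicit Defensive.
Import Order.TTheory GRing.Theory Num.Theory.
Local Open Scope ring_scope.

Section Cutting.
Variables (V : finType) (e : rel V) (S : {set V}).

(* Every graph met by the procedure is an induced subgraph of the initial
   graph (V, e), so it is represented by its vertex set. *)
Definition induced (W : {set V}) : rel V :=
  [rel x y | [&& x \in W, y \in W & e x y]].

Definition component (W : {set V}) (x : V) : {set V} :=
  [set y in W | connect (induced W) x y].

Definition prune (W : {set V}) : {set V} :=
  [set x in W | component W x :&: S != finset.set0].

Definition cut (W : {set V}) (v : V) : {set V} :=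
  if v \in W then prune (W :\ v) else W.

Definition cut_all (s : seq V) : {set V} := foldl cut finset.setT s.

(* The 0-based entry [v i] is the vertex chosen at step i + 1. *)
Definition graph_at_step (v : nat -> V) (i : nat) : {set V} :=
  cut_all (mkseq v i).

(* A realisation is a total sequence; its entries after the empty graph has been
   reached are irrelevant, [cut] having no effect on the empty graph. *)
Definition cutting_realisation (v : nat -> V) : Prop :=
  forall i, graph_at_step v i != finset.set0 -> v i \in graph_at_step v i.

Section Continuous.
Variables (R : realType).

(* The clocks that have rung by time t, in chronological order. Simultaneous
   rings, a null event, are processed in the order of [enum V]. *)
Definition rung (x : V -> R) (t : R) : seq V :=
  [seq v <- sort (fun u v => x u <= x v) (enum V) | x v <= t].

Definition graph_at_time (x : V -> R) (t : R) : {set V} :=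
  cut_all (rung x t).

End Continuous.
End Cutting.

Local Open Scope classical_set_scope.

Section Numbers.
Variables (R : realType) (V : finType) (e : rel V) (S T : {set V}).

(* The infima are taken in \bar R, where inf of the empty set is +oo. *)
Definition cutting_number (v : nat -> V) : \bar R :=
  ereal_inf [set (i%:R)%:E | i in
    [set i : nat | graph_at_step e S v i = finset.set0]].

Definition separation_number (v : nat -> V) : \bar R :=
  ereal_inf [set (i%:R)%:E | i in
    [set i : nat | graph_at_step e S v i :&: T = finset.set0]].

Definition cutting_time (x : V -> R) : \bar R :=
  ereal_inf [set t%:E | t in
    [set t : R | 0 <= t /\ graph_at_time e S x t = finset.set0]].

Definition separation_time (x : V -> R) : \bar R :=
  ereal_inf [set t%:E | t in
    [set t : R | 0 <= t /\ graph_at_time e S x t :&: T = finset.set0]].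

End Numbers.

Section Models.
Variables (R : realType) (d : measure_display) (Omega : measurableType d).
Variables (P : probability Omega R) (V : finType).

(* The last field says that, given any history [a] of choices leading to a
   nonempty graph, the next choice is uniform on the vertices of that graph. *)
Record cutting_procedure (e : rel V) (S : {set V}) (v : nat -> Omega -> V)
    : Prop := CuttingProcedure {
  choice_measurable : forall i u, measurable [set w | v i w = u];
  choice_realisation : forall w, cutting_realisation e S (v ^~ w);
  choice_uniform : forall (a : seq V) (u : V), u \in cut_all e S a ->
    P [set w | mkseq (v ^~ w) (size a) = a /\ v (size a) w = u] =
    (P [set w | mkseq (v ^~ w) (size a) = a]
       * ((#|cut_all e S a|%:R)^-1)%:E)%E }.

Definition mutually_independent (X : V -> {RV P >-> R}) : Prop :=
  forall (J : {set V}) (B : V -> set R), (forall v, measurable (B v)) ->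
    P [set w | forall v, v \in J -> B v (X v w)] =
    (\prod_(v in J) P (X v @^-1` B v))%E.

Record exponential_clocks (X : V -> {RV P >-> R}) : Prop := ExponentialClocks {
  clocks_independent : mutually_independent X;
  clocks_exponential : forall v (B : set R), measurable B ->
    distribution P (X v) B = exponential_prob 1 B }.

(* Only meaningful for measurable [Y] and [Z], which the cutting and separation
   numbers and times of the two models are. *)
Definition eq_in_distribution (Y Z : Omega -> \bar R) : Prop :=
  forall B : set (\bar R), measurable B -> P (Y @^-1` B) = P (Z @^-1` B).

End Models.

(* Main.v *)
Require Import Defs.
From mathcomp Require Import all_boot all_order all_algebra.
From mathcomp Require Import all_classical all_reals all_analysis.
From mathcomp Require Import measurable_realfun.

Set Implicit Arguments.
Unset Strict Implicit.
Unset Printing Implicit Defensive.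
Import Order.TTheory GRing.Theory Num.Theory.
Import numFieldNormedType.Exports.
Local Open Scope ring_scope.

(** Every graph met by the procedure is either empty or contains a source
    ([cut_all_source]), because each surviving component does. The empty graph
    contains no target, so separation never comes after the end of the cutting;
    and when [S \subset T] a graph without targets has no source, hence is
    empty, so the two coincide. Both facts hold graph by graph and apply
    verbatim to discrete and to continuous time.

    For the converse, suppose that [s] is a source and not a target. A source
    survives until it is cut itself ([source_in_cut_all]), whatever else is cut.
    If everything but [s] is removed first, the graph is at some point [{s}]: the
    targets are separated but the cutting is not over. This scenario has positive
    probability in both models. In discrete time one always cuts some vertex
    other than [s]; each of these choices has conditional probability at least
    [1 / #|V|] ([likely_history]). In continuous time the clocks are
    independent and each falls in any given interval of positive numbers with
    positive probability ([exponential_clock_gt0]), so [s] may well ring last.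
    Hence for some [t] the event [separation <= t < cutting] has positive probability. As
    [{cutting <= t}] is contained in [{separation <= t}], the two laws then give
    different mass to [[-oo, t]] ([neq_in_distribution]).

    The comparison with [t] is read off the graph at [t]: graphs only decrease,
    and in continuous time they are right-continuous step functions, so the
    infima are attained ([separation_number_le], [separation_time_le]). The
    events involved then depend on finitely many finite-valued random variables,
    which makes them measurable. The cutting number is the separation number for
    the target set of all vertices, so each such fact is proved once. *)

(** * Sources and survival under successive cuts *)

Section CutGraphs.
Variables (V : finType) (e : rel V) (S : {set V}).
Implicit Types (W : {set V}) (a b : seq V).

Lemma prune_subset W : prune e S W \subset W.
Proof. by apply/fintype.subsetP => x; rewrite inE => /andP[]. Qed.

Lemma cut_subset W v : Defs.cut e S W v \subset W.
Proof.
rewrite /Defs.cut; case: ifP => // _.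
exact: fintype.subset_trans (prune_subset _) (finset.subsetDl _ _).
Qed.

Lemma cut_all_rcons a v : cut_all e S (rcons a v) = Defs.cut e S (cut_all e S a) v.
Proof. by rewrite /cut_all -cats1 foldl_cat. Qed.

Lemma cut_all_cat_subset a b : cut_all e S (a ++ b) \subset cut_all e S a.
Proof.
elim/last_ind: b => [|b v IH]; first by rewrite cats0.
by rewrite -rcons_cat cut_all_rcons (fintype.subset_trans (cut_subset _ _)).
Qed.

Lemma notin_cut W v : v \notin Defs.cut e S W v.
Proof.
rewrite /Defs.cut; case: ifPn => // _.
by apply: contra (fintype.subsetP (prune_subset _) v) _; rewrite !inE eqxx.
Qed.

Lemma notin_cut_all a v : v \in a -> v \notin cut_all e S a.
Proof.
case/path.splitPr => a1 a2; rewrite -cat_rcons; apply/negP.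
move=> /(fintype.subsetP (cut_all_cat_subset _ _)); apply/negP.
by rewrite cut_all_rcons notin_cut.
Qed.

Lemma source_in_prune W s : s \in S -> s \in W -> s \in prune e S W.
Proof.
move=> sS sW; rewrite inE sW; apply/set0Pn; exists s.
by rewrite !inE sW sS connect0.
Qed.

Lemma source_in_cut W s v :
  s \in S -> s \in W -> v != s -> s \in Defs.cut e S W v.
Proof.
move=> sS sW vs; rewrite /Defs.cut; case: ifP => // _.
by rewrite source_in_prune // !inE eq_sym vs.
Qed.

Lemma source_in_cut_all a s :
  s \in S -> s \notin a -> s \in cut_all e S a.
Proof.
move=> sS; elim/last_ind: a => [|a v IH]; first by rewrite inE.
rewrite mem_rcons inE negb_or eq_sym cut_all_rcons => /andP[vs /IH sa].
exact: source_in_cut.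
Qed.

(** The source that keeps a component alive belongs to that component, hence
    survives with it. *)
Lemma prune_source W :
  prune e S W != finset.set0 -> prune e S W :&: S != finset.set0.
Proof.
case/set0Pn => x; rewrite inE => /andP[_ /set0Pn[s]].
rewrite !inE => /andP[/andP[sW _] sS]; apply/set0Pn; exists s.
by rewrite inE sS source_in_prune.
Qed.

Lemma cut_all_source a : S != finset.set0 ->
  cut_all e S a != finset.set0 -> cut_all e S a :&: S != finset.set0.
Proof.
move=> S0; elim/last_ind: a => [|a v IH]; first by rewrite finset.setTI.
by rewrite cut_all_rcons /Defs.cut; case: ifP => // _; apply: prune_source.
Qed.

Lemma cut_all_separated a (T : {set V}) : S != finset.set0 -> S \subset T ->
  cut_all e S a :&: T = finset.set0 -> cut_all e S a = finset.set0.
Proof.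
move=> S0 ST aT; apply/eqP; apply: contraT => /(cut_all_source S0).
by rewrite -finset.subset0 -aT finset.setIS.
Qed.

Lemma separated_by_last_source a s (T : {set V}) :
  cut_all e S a \subset [set s]%SET -> s \notin T ->
  cut_all e S a :&: T = finset.set0.
Proof.
move=> /fintype.subsetP as1 sT; apply/setP => x; rewrite !inE.
by apply/negbTE/negP => /andP[/as1/set1P->]; apply/negP.
Qed.

Lemma graph_at_step_anti (v : nat -> V) i j : (i <= j)%N ->
  graph_at_step e S v j \subset graph_at_step e S v i.
Proof.
move=> ij; rewrite /graph_at_step -(subnKC ij) /mkseq iotaD map_cat.
exact: cut_all_cat_subset.
Qed.

End CutGraphs.

(** * The graph as a function of time *)

Section Clocks.
Variables (R : realType) (V : finType) (e : rel V) (S : {set V}).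
Implicit Types x : V -> R.

Lemma mem_rung x t v : (v \in rung x t) = (x v <= t).
Proof. by rewrite mem_filter mem_sort mem_enum andbT. Qed.

(** In a list sorted by ringing time, the clocks rung by time [t] form an initial
    segment; with [cut_all_cat_subset] this makes the graph decrease in time. *)
Lemma rung_cat x t t' : t <= t' -> exists b, rung x t' = rung x t ++ b.
Proof.
move=> tt'; exists
  [seq v <- sort (fun u v => x u <= x v) (enum V) | t < x v <= t'].
rewrite /rung.
have: sorted (fun u v => x u <= x v) (sort (fun u v => x u <= x v) (enum V)).
  by apply: sort_sorted => u v; apply: le_total.
elim: (sort _ _) => // u s IH /= us; move: (us).
rewrite (path_sortedE (fun _ _ _ => @le_trans _ _ _ _ _)) => /andP[su /IH ->].
have [ut|tu] /= := leP (x u) t; first by rewrite (le_trans ut tt').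
have -> : [seq v <- s | x v <= t] = [::].
  rewrite -(filter_pred0 s); apply: eq_in_filter => v /(allP su) uv.
  by apply/negbTE; rewrite -ltNge (lt_le_trans tu).
by [].
Qed.

Lemma graph_at_time_anti x t t' : t <= t' ->
  graph_at_time e S x t' \subset graph_at_time e S x t.
Proof.
by case/(rung_cat x) => b; rewrite /graph_at_time => ->; exact: cut_all_cat_subset.
Qed.

(** There are finitely many clocks, so none rings just after [t]. *)
Lemma graph_at_time_right_constant x t :
  exists2 t1, t < t1 & graph_at_time e S x t1 = graph_at_time e S x t.
Proof.
have near_t : \forall t1 \near at_right t, forall v, (x v <= t1) = (x v <= t).
  apply: filter_forall => v.
  have [vt|tv] := leP (x v) t.
    by near=> t1; apply: le_trans vt _; apply/ltW; near: t1; exact: nbhs_right_gt.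
  near=> t1; apply/negbTE; rewrite -ltNge; near: t1; exact: nbhs_right_lt.
near (at_right t) => t1; exists t1; first by near: t1; exact: nbhs_right_gt.
have eq_t1 v : (x v <= t1) = (x v <= t) by move: v; near: t1.
rewrite /graph_at_time /rung; congr cut_all.
exact: eq_filter.
Unshelve. all: by end_near.
Qed.

End Clocks.

Local Open Scope classical_set_scope.

(** * Cutting and separation numbers and times *)

Section Numbers.
Variables (R : realType) (V : finType) (e : rel V) (S : {set V}).

Lemma cutting_numberE v :
  cutting_number R e S v = separation_number R e S finset.setT v.
Proof.
by rewrite /separation_number; under eq_set do rewrite finset.setIT.
Qed.

Lemma cutting_timeE (x : V -> R) :
  cutting_time e S x = separation_time e S finset.setT x.
Proof.
by rewrite /separation_time; under eq_set do rewrite finset.setIT.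
Qed.

Lemma separation_number_le_cutting_number (T : {set V}) v :
  (separation_number R e S T v <= cutting_number R e S v)%E.
Proof.
apply: ereal_inf_le_tmp; apply: image_subset => i /= ->.
by rewrite finset.set0I.
Qed.

Lemma separation_time_le_cutting_time (T : {set V}) (x : V -> R) :
  (separation_time e S T x <= cutting_time e S x)%E.
Proof.
apply: ereal_inf_le_tmp; apply: image_subset => t /= [t0 ->].
by rewrite finset.set0I.
Qed.

Lemma separation_number_eq_cutting_number (T : {set V}) v :
  S != finset.set0 -> S \subset T ->
  separation_number R e S T v = cutting_number R e S v.
Proof.
move=> S0 ST; apply/le_anti.
rewrite separation_number_le_cutting_number /=.
apply: ereal_inf_le_tmp; apply: image_subset => i /=.
exact: cut_all_separated.
Qed.

Lemma separation_time_eq_cutting_time (T : {set V}) (x : V -> R) :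
  S != finset.set0 -> S \subset T ->
  separation_time e S T x = cutting_time e S x.
Proof.
move=> S0 ST; apply/le_anti.
rewrite separation_time_le_cutting_time /=.
apply: ereal_inf_le_tmp; apply: image_subset => t /= [t0 tT].
by split=> //; exact: cut_all_separated tT.
Qed.

Lemma separation_number_le (T : {set V}) v k :
  (separation_number R e S T v <= (k%:R)%:E)%E <->
  graph_at_step e S v k :&: T = finset.set0.
Proof.
split=> [|kT]; last by apply: ge_ereal_inf; exists (k%:R)%:E => //; exists k.
apply: contraPP => kT; apply/negP; rewrite -ltNge.
apply: (@lt_le_trans _ _ (k.+1%:R)%:E); first by rewrite lte_fin ltr_nat.
apply: le_ereal_inf_tmp => _ [i /= iT <-]; rewrite lee_fin ler_nat ltnNge.
apply/negP => ik; apply: kT; apply/eqP; rewrite -finset.subset0 -iT.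
by rewrite finset.setSI // graph_at_step_anti.
Qed.

Lemma separation_time_le (T : {set V}) (x : V -> R) t : 0 <= t ->
  (separation_time e S T x <= t%:E)%E <->
  graph_at_time e S x t :&: T = finset.set0.
Proof.
move=> t0; split=> [|tT]; last by apply: ge_ereal_inf; exists t%:E => //; exists t.
apply: contraPP => tT; apply/negP; rewrite -ltNge.
have [t1 tt1 eq_t1] := graph_at_time_right_constant e S x t.
(* A graph without targets before t1 would contain the one at t1, hence at t. *)
apply: (@lt_le_trans _ _ t1%:E) => //.
apply: le_ereal_inf_tmp => _ [i /= [_ iT] <-]; rewrite lee_fin leNgt.
apply/negP => /ltW/(graph_at_time_anti e S x) it1; apply: tT; apply/eqP.
by rewrite -finset.subset0 -iT finset.setSI // -eq_t1.
Qed.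

End Numbers.

(** * A criterion for distinct laws *)

Section Probability.
Variables (R : realType) (d : measure_display) (Omega : measurableType d).
Variable (P : probability Omega R).

(** The event is a finite union, over the joint values [g] satisfying [Q], of
    finite intersections of the events [f i = g i]. *)
Lemma measurable_finite_valued (I F : finType) (f : I -> Omega -> F)
    (Q : {ffun I -> F} -> Prop) :
  (forall i y, measurable [set w | f i w = y]) ->
  measurable [set w | Q [ffun i => f i w]].
Proof.
move=> mf.
have -> : [set w | Q [ffun i => f i w]] =
    \bigcup_(g in [set g : {ffun I -> F} | Q g])
      \bigcap_(i in [set: I]) [set w | f i w = g i].
  apply/seteqP; split=> [w Qw|w [g Qg wg]] /=.
    by exists [ffun i => f i w] => // i _ /=; rewrite ffunE.
  by rewrite (_ : finfun _ = g) //; apply/ffunP => i; rewrite ffunE; exact: wg.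
apply: fin_bigcup_measurable => // g _.
by apply: fin_bigcap_measurable => // i _; exact: mf.
Qed.

(** The disjoint events [Z <= t] and [A] both lie in [Y <= t], so the latter has
    larger probability than the former. *)
Lemma neq_in_distribution (Y Z : Omega -> \bar R) (t : R) (A : set Omega) :
  (forall w, (Y w <= Z w)%E) ->
  measurable [set w | (Y w <= t%:E)%E] ->
  measurable [set w | (Z w <= t%:E)%E] ->
  measurable A -> (0 < P A)%E ->
  (forall w, A w -> (Y w <= t%:E)%E /\ (t%:E < Z w)%E) ->
  ~ eq_in_distribution P Y Z.
Proof.
move=> YZ mY mZ mA PA AYZ /(_ [set y | (y <= t%:E)%E]).
have mt : measurable [set y : \bar R | (y <= t%:E)%E].
  by have := emeasurable_itv (Interval -oo%O (BRight t%:E)); rewrite set_itvE.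
move=> /(_ mt) eqYZ.
have: (P ([set w | (Z w <= t%:E)%E] `|` A) <= P [set w | (Y w <= t%:E)%E])%E.
  apply: le_measure; rewrite ?inE //; first exact: measurableU.
  by move=> w [/=|/AYZ[]//]; exact: le_trans.
rewrite measureU //; last first.
  apply/seteqP; split=> // w [/= Zt /AYZ[_]].
  by rewrite ltNge Zt.
rewrite -[P [set w | (Y w <= _)%E]]/(P (Y @^-1` [set y | (y <= t%:E)%E])) eqYZ.
rewrite leNgt => /negP; apply.
by rewrite lteDl // fin_num_measure.
Qed.

End Probability.

(** * The two random models *)

Section Models.
Variables (R : realType) (d : measure_display) (Omega : measurableType d).
Variables (P : probability Omega R) (V : finType) (e : rel V) (S : {set V}).

Lemma measurable_history (v : nat -> Omega -> V) (Q : seq V -> Prop) k :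
  (forall i u, measurable [set w | v i w = u]) ->
  measurable [set w | Q (mkseq (v ^~ w) k)].
Proof.
move=> mv; have := measurable_finite_valued
  (fun g : {ffun 'I_k -> V} => Q [seq g i | i <- enum 'I_k])
  (fun i : 'I_k => mv i).
congr (measurable _); apply/funext => w /=; congr Q.
rewrite /mkseq -val_enum_ord -map_comp.
by apply: eq_map => i /=; rewrite ffunE.
Qed.

(** The list of rung clocks is determined by the outcomes of the comparisons
    between clocks and of each clock with [t]. *)
Lemma measurable_rung (X : V -> {RV P >-> R}) (Q : seq V -> Prop) t :
  measurable [set w | Q (rung (X ^~ w) t)].
Proof.
pose f (i : V * V + V) (w : Omega) : bool :=
  match i with inl p => X p.1 w <= X p.2 w | inr v => X v w <= t end.
have mf i b : measurable [set w | f i w = b].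
  have mfi : measurable_fun setT (f i).
    case: i => [p|v] /=; exact: measurable_fun_ler.
  by have := mfi measurableT [set b] I; rewrite setTI.
have := measurable_finite_valued (fun g : {ffun V * V + V -> bool} =>
  Q [seq v <- sort (fun u v => g (inl (u, v))) (enum V) | g (inr v)]) mf.
congr (measurable _); apply/funext => w /=; congr Q; rewrite /rung.
have -> : (fun u v => [ffun i => f i w] (inl (u, v))) =
          (fun u v => X u w <= X v w).
  by apply/funext => u; apply/funext => v; rewrite ffunE.
by apply: eq_filter => v; rewrite ffunE.
Qed.

Lemma history_rcons_gt0 (v : nat -> Omega -> V) a u :
  cutting_procedure P e S v -> u \in cut_all e S a ->
  (0 < P [set w | mkseq (v ^~ w) (size a) = a])%E ->
  (0 < P [set w | mkseq (v ^~ w) (size (rcons a u)) = rcons a u])%E.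
Proof.
move=> cv ua Pa.
rewrite [X in P X](_ : _ = [set w | mkseq (v ^~ w) (size a) = a /\
    v (size a) w = u]); last first.
  apply/seteqP; split=> w /=; rewrite size_rcons mkseqS.
    by move/rcons_inj => [].
  by move=> [-> ->].
rewrite (choice_uniform cv ua) mule_gt0 // lte_fin invr_gt0 ltr0n.
by apply/card_gt0P; exists u.
Qed.

(** Keep cutting any vertex other than [s]: the graph shrinks at each step, [s]
    stays in it, and every choice has positive conditional probability. *)
Lemma likely_history (v : nat -> Omega -> V) s :
  cutting_procedure P e S v -> s \in S ->
  exists a, [/\ s \notin a, cut_all e S a \subset [set s]%SET &
    (0 < P [set w | mkseq (v ^~ w) (size a) = a])%E].
Proof.
move=> cv sS.
suff main m a : (#|cut_all e S a| <= m)%N -> s \notin a ->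
    (0 < P [set w | mkseq (v ^~ w) (size a) = a])%E ->
    exists a', [/\ s \notin a', cut_all e S a' \subset [set s]%SET &
      (0 < P [set w | mkseq (v ^~ w) (size a') = a'])%E].
  apply: (main #|cut_all e S [::]| [::]) => //=.
  rewrite [X in P X](_ : _ = setT); first by rewrite probability_setT.
  by apply/seteqP; split.
elim: m a => [|m IH] a.
  rewrite leqn0 cards_eq0 => /eqP a0 sa Pa.
  by exists a; split=> //; rewrite a0 finset.sub0set.
move=> am sa Pa; have [as1|] := boolP (cut_all e S a \subset [set s]%SET).
  by exists a.
case/fintype.subsetPn => u ua; rewrite finset.in_set1 => us.
apply: (IH (rcons a u)).
- rewrite -ltnS (leq_trans _ am) // proper_card // cut_all_rcons.
  apply/properP; split; first exact: cut_subset.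
  by exists u => //; exact: notin_cut.
- by rewrite mem_rcons inE negb_or eq_sym us.
- exact: history_rcons_gt0.
Qed.

(** On [[0, c]] the exponential law has mass [1 - exp (- c)], which is injective
    in [c]. *)
Lemma exponential_clock_gt0 (X : V -> {RV P >-> R}) v (a b : R) :
  exponential_clocks X -> 0 < a -> a < b ->
  (0 < P (X v @^-1` `]a, b]%classic))%E.
Proof.
move=> [_ eX] a0 ab; rewrite lt0e measure_ge0 andbT; apply/eqP => Pab.
have cdf (c : R) : 0 < c ->
    P (X v @^-1` `[0, c]%classic) = (1 - (expR (- c))%:E)%E.
  move=> c0; have := eX v `[0, c]%classic (measurable_itv _).
  by rewrite exponential_prob_itv0c // mulN1r.
have : P (X v @^-1` `[0, b]%classic) =
    (P (X v @^-1` `[0%R, a]%classic) + P (X v @^-1` `]a, b]%classic))%E.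
  rewrite -measureU.
  - by rewrite -preimage_setU -itv_bndbnd_setU // bnd_simp ltW.
  - by rewrite -[_ @^-1` _]setTI; exact: measurable_funP.
  - by rewrite -[_ @^-1` _]setTI; exact: measurable_funP.
  - apply/seteqP; split=> // w [] /=; rewrite !in_itv /=.
    by move=> /andP[_ wa] /andP[]; rewrite ltNge wa.
rewrite Pab adde0 !cdf ?(lt_trans a0 ab) // => -[].
by move=> /addrI/oppr_inj/expR_inj/oppr_inj eq_ab; move: ab; rewrite eq_ab ltxx.
Qed.

(** Along the history of [likely_history] the targets are separated while the
    source [s] is still uncut, so with positive probability separation strictly
    precedes the end of the cutting. *)
Lemma sources_sub_targets_of_number (T : {set V}) (v : nat -> Omega -> V) :
  cutting_procedure P e S v ->
  eq_in_distribution P (fun w => separation_number R e S T (v ^~ w))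
    (fun w => cutting_number R e S (v ^~ w)) ->
  S \subset T.
Proof.
move=> cv; apply: contraPT => /fintype.subsetPn[s sS sT].
have [a [sa as1 Pa]] := likely_history cv sS.
have mv := choice_measurable cv.
have mle T' : measurable [set w |
    (separation_number R e S T' (v ^~ w) <= ((size a)%:R)%:E)%E].
  rewrite (_ : mkset _ = [set w |
    (fun b => cut_all e S b :&: T' = finset.set0) (mkseq (v ^~ w) (size a))]).
    exact: (measurable_history (fun b => cut_all e S b :&: T' = _)).
  by apply/seteqP; split=> w /= /separation_number_le.
apply: (neq_in_distribution _ _ _ _ Pa) => //.
- by move=> w; exact: separation_number_le_cutting_number.
- by under eq_set do rewrite cutting_numberE.
- exact: (measurable_history (fun b => b = a)).
- move=> w /= wa; rewrite cutting_numberE.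
  have gE : graph_at_step e S (v ^~ w) (size a) = cut_all e S a.
    by rewrite /graph_at_step wa.
  split.
    apply/separation_number_le; rewrite gE.
    exact: separated_by_last_source sT.
  rewrite ltNge; apply/negP => /separation_number_le.
  rewrite gE finset.setIT => a0.
  by have := source_in_cut_all e sS sa; rewrite a0 inE.
Qed.

(** If [s] is a source outside [T], the clock of [s] rings in ]2, 3] and all the
    others in ]1, 2] with positive probability; then exactly [s] is left at
    time 2. *)
Lemma sources_sub_targets_of_time (T : {set V}) (X : V -> {RV P >-> R}) :
  exponential_clocks X ->
  eq_in_distribution P (fun w => separation_time e S T (X ^~ w))
    (fun w => cutting_time e S (X ^~ w)) ->
  S \subset T.
Proof.
move=> eX; apply: contraPT => /fintype.subsetPn[s sS sT].
have mle T' : measurable [set w |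
    (separation_time e S T' (X ^~ w) <= 2%:E)%E].
  rewrite (_ : mkset _ = [set w |
    (fun b => cut_all e S b :&: T' = finset.set0) (rung (X ^~ w) 2)]).
    exact: (measurable_rung X (fun b => cut_all e S b :&: T' = _)).
  by apply/seteqP; split=> w /= /separation_time_le; apply.
pose B u : set R := if u == s then `]2, 3] else `]1, 2].
have mB u : measurable (B u) by rewrite /B; case: ifP.
have mX u : measurable (X u @^-1` B u).
  by rewrite -[_ @^-1` _]setTI; exact: measurable_funP.
have AE : [set w | forall u, u \in finset.setT -> B u (X u w)] =
    \bigcap_(u in setT) (X u @^-1` B u).
  by apply/seteqP; split=> w /= Bw u // _; apply: Bw; rewrite ?inE.
have PA : (0 < P [set w | forall u, u \in finset.setT -> B u (X u w)])%E.
  rewrite (clocks_independent eX) //.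
  elim/big_ind: _ => [|p q p0 q0|u _] //; first exact: mule_gt0.
  rewrite /B; case: ifP => _; apply: exponential_clock_gt0 => //;
    by rewrite ?ltr0n ?ltr1n ?ltr_nat ?ltr01.
apply: (neq_in_distribution _ _ _ _ PA) => //.
- by move=> w; exact: separation_time_le_cutting_time.
- by under eq_set do rewrite cutting_timeE.
- by rewrite AE; apply: fin_bigcap_measurable.
- move=> w /= Bw; rewrite cutting_timeE.
  have rungE u : (u \in rung (X ^~ w) 2) = (u != s).
    rewrite mem_rung; have := Bw u (finset.in_setT u); rewrite /B.
    case: eqP => _ /=; rewrite in_itv /= => /andP[].
      by rewrite ltNge => /negbTE.
    by [].
  split.
    apply/separation_time_le => //; apply: separated_by_last_source sT.
    apply/fintype.subsetP => u; rewrite finset.in_set1; apply: contraLR.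
    by rewrite -rungE; exact: notin_cut_all.
  rewrite ltNge; apply/negP => /separation_time_le; rewrite finset.setIT.
  move=> /(_ (ler0n _ 2)) a0.
  have := @source_in_cut_all _ e S (rung (X ^~ w) 2) s sS.
  by rewrite rungE eqxx -/(graph_at_time e S _ _) a0 inE => /(_ isT).
Qed.

End Models.

Theorem proposition6 (R : realType) (V : finType) (e : rel V) (S T : {set V})
    (e_sym : symmetric e) (e_irr : irreflexive e)
    (e_conn : forall x y : V, connect e x y) (S_neq0 : S != finset.set0) :
  [/\ forall v : nat -> V, cutting_realisation e S v ->
        (separation_number R e S T v <= cutting_number R e S v)%E,
      S \subset T -> forall v : nat -> V, cutting_realisation e S v ->
        separation_number R e S T v = cutting_number R e S v
    & forall (d : measure_display) (Omega : measurableType d)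
        (P : probability Omega R) (v : nat -> Omega -> V),
        cutting_procedure P e S v ->
        eq_in_distribution P
          (fun w => separation_number R e S T (v ^~ w))
          (fun w => cutting_number R e S (v ^~ w)) ->
        S \subset T]
  /\
  [/\ forall x : V -> R,
        (separation_time e S T x <= cutting_time e S x)%E,
      S \subset T -> forall x : V -> R,
        separation_time e S T x = cutting_time e S x
    & forall (d : measure_display) (Omega : measurableType d)
        (P : probability Omega R) (X : V -> {RV P >-> R}),
        exponential_clocks X ->
        eq_in_distribution P
          (fun w => separation_time e S T (X ^~ w))
          (fun w => cutting_time e S (X ^~ w)) ->
        S \subset T].
Proof.
split; split.
- by move=> v _; exact: separation_number_le_cutting_number.
- by move=> ST v _; exact: separation_number_eq_cutting_number.
- by move=> d Omega P v; exact: sources_sub_targets_of_number.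
- by move=> x; exact: separation_time_le_cutting_time.
- by move=> ST x; exact: separation_time_eq_cutting_time.
- by move=> d Omega P X; exact: sources_sub_targets_of_time.
Qed.
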